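(* For any $\epsilon\in(1/n^{1/4},1/4)$, any deterministic algorithm that queries entries of a bounded entry matrix $\mathbf A\in\mathbb{R}^{n\times n}$ non-adaptively and outputs $\widetilde\sigma_1$ satisfying $|\sigma_1(\mathbf A)-\widetilde\sigma_1|\le\epsilon\cdot\max(n,\|\mathbf A\|_1)$ must read at least $\Omega(n/\epsilon^4)$ entries.
   Context: A matrix has bounded entries if all its entries have absolute value at most $1$. $\sigma_1(\mathbf A)=\|\mathbf A\|_2$ is the largest singular value and $\|\mathbf A\|_1$ is the nuclear norm (sum of singular values). Non-adaptive means the set of queried positions is fixed independently of the input. *)

(* Defs.v *)
From HB Require Import structures.
From mathcomp Require Import all_boot all_order all_algebra.
From mathcomp Require Import polyrcf.
From mathcomp Require Import reals.

Set Implicit Arguments.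
Unset Strict Implicit.
Unset Printing Implicit Defensive.

Import Order.TTheory GRing.Theory Num.Theory.
Local Open Scope ring_scope.

Definition bounded_entries (R : realType) (m n : nat) (A : 'M[R]_(m, n)) : Prop :=
  forall i j, `|A i j| <= 1.

(* The square roots of the eigenvalues of A^T A, with multiplicity, in
   nonincreasing order.  [rootsR p] lists the distinct real roots of p without
   repetition, so the algebraic multiplicities are put back with [mup].  As
   A^T A is symmetric positive semidefinite, all its eigenvalues are real and
   nonnegative, and the resulting sequence has n elements (some may be 0). *)
Definition singular_values (R : realType) (m n : nat) (A : 'M[R]_(m, n)) : seq R :=
  let p := char_poly (A^T *m A) in
  sort (fun x y => y <= x)
    (flatten [seq nseq (mup x p) (Num.sqrt x) | x <- rootsR p]).

Definition sigma1 (R : realType) (m n : nat) (A : 'M[R]_(m, n)) : R :=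
  head 0 (singular_values A).

Definition nuclear_norm (R : realType) (m n : nat) (A : 'M[R]_(m, n)) : R :=
  \sum_(s <- singular_values A) s.

(* A deterministic non-adaptive algorithm on n x n matrices: a set of positions
   fixed in advance, and an arbitrary function of the values found there.
   The domain of [output] contains nothing but the answers, so the result
   cannot depend on any other entry of the input. *)
Record nonadaptive_algorithm (R : realType) (n : nat) := NonadaptiveAlgorithm {
  queries : {set 'I_n * 'I_n};
  output : {ffun {p : 'I_n * 'I_n | p \in queries} -> R} -> R
}.

Definition run (R : realType) (n : nat) (alg : nonadaptive_algorithm R n)
    (A : 'M[R]_n) : R :=
  output [ffun p : {p | p \in queries alg} => A (val p).1 (val p).2].

(* Main.v *)
(* Suppose fewer than n / (81 eps^4) entries are read.  Averaging over rows
   gives a set I of a rows, with 8 eps^2 n < a <= 9 eps^2 n, containing at most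
   a / (81 eps^4) queries in total.  Let A be 1 on the rows in I and 0 elsewhere,
   and let B be A with its unread entries set to 0: the algorithm gives the same
   answer on both.  A has rank at most 1, so sigma1 A >= sqrt (a n) while its
   nuclear norm is at most n.  B has rank at most a, so by Cauchy-Schwarz its
   nuclear norm is at most sqrt a times its Frobenius norm, hence at most n,
   while sigma1 B <= sqrt (a n) / 9.  The gap then exceeds 2 eps n.

   That A^T A has only real eigenvalues comes from the spectral theorem over the
   complex numbers R[i]. *)
Require Import Defs.
From HB Require Import structures.
From mathcomp Require Import all_boot all_order all_algebra.
From mathcomp Require Import spectral polyrcf complex.
From mathcomp Require Import reals exp.
From mathcomp Require Import ring lra zify.

Set Implicit Arguments.
Unset Strict Implicit.
Unset Printing Implicit Defensive.

Import Order.TTheory GRing.Theory Num.Theory.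
Local Open Scope ring_scope.

(** * Spectrum of a real symmetric matrix *)

Lemma char_poly_conj (F : fieldType) n (V P M : 'M[F]_n) :
  V *m P = 1%:M -> char_poly (V *m M *m P) = char_poly M.
Proof.
move=> VP1; rewrite /char_poly.
suff -> : char_poly_mx (V *m M *m P) =
    map_mx polyC V *m char_poly_mx M *m map_mx polyC P.
  rewrite !det_mulmx mulrAC -det_mulmx -map_mxM VP1 map_mx1 det1 mul1r //.
rewrite /char_poly_mx mulmxBr mulmxBl -!map_mxM; congr (_ - _).
by rewrite mul_mx_scalar -scalemxAl -map_mxM VP1 map_mx1 scalemx1.
Qed.

Lemma char_poly_diag (F : fieldType) n (d : 'rV[F]_n) :
  char_poly (diag_mx d) = \prod_i ('X - (d 0 i)%:P).
Proof.
rewrite char_poly_trig ?diag_mx_is_trig //.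
by apply: eq_bigr => i _; rewrite !mxE eqxx mulr1n.
Qed.

(** The submatrix on the support of [d] is diagonal and invertible, and selecting rows or columns
    cannot raise the rank. *)
Lemma card_supp_le_rank_diag (F : fieldType) n (d : 'rV[F]_n) :
  (#|[set i | d 0%R i != 0%R]| <= \rank (diag_mx d))%N.
Proof.
set I := [set i | _].
pose f (k : 'I_#|I|) : 'I_n := enum_val k.
have subE : mxsub f f (diag_mx d) = diag_mx (\row_k d 0 (f k)).
  apply/matrixP => k l; rewrite !mxE.
  by rewrite (inj_eq enum_val_inj).
have unitE : mxsub f f (diag_mx d) \in unitmx.
  rewrite subE unitmxE det_diag unitfE; apply/prodf_neq0 => k _.
  by rewrite mxE; have := enum_valP k; rewrite inE.
rewrite -{1}(mxrank_unit unitE).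
have -> : mxsub f f (diag_mx d) = (rowsub f (rowsub f (diag_mx d))^T)^T.
  by apply/matrixP => k l; rewrite !mxE.
rewrite mxrank_tr (leq_trans (mxrankS (rowsub_sub _ _))) // mxrank_tr.
exact: mxrankS (rowsub_sub _ _).
Qed.

(** Over [R[i]], [M] is Hermitian, hence diagonalizable with real diagonal. The characteristic
    polynomial, trace and rank are then carried back along the embedding of [R]. *)
Lemma symmetric_spectrum (R : rcfType) n (M : 'M[R]_n) : M^T = M ->
  exists d : 'rV[R]_n,
    [/\ char_poly M = \prod_i ('X - (d 0 i)%:P),
        \tr M = \sum_i d 0 i
      & (#|[set i | d 0%R i != 0%R]| <= \rank M)%N].
Proof.
move=> Msym; pose f := real_complex R; pose N := map_mx f M.
have Nreal : N \is a mxOver Num.real.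
  by apply/mxOverP => i j; rewrite mxE complex_real.
have Nsym : N \is symmetricmx.
  by apply/is_hermitianmxP; rewrite expr0 scale1r map_mx_id // /N map_trmx Msym.
have Nherm := realsym_hermsym Nsym Nreal.
have NE := orthomx_spectralP (hermitian_normalmx Nherm).
have Dreal := hermitian_spectral_diag_real Nherm.
have Punit := spectral_unit N.
move: NE Dreal Punit; set P := spectralmx N; set D := spectral_diag N.
move=> NE Dreal Punit.
pose d : 'rV[R]_n := \row_i complex.Re (D 0 i).
have dE : D = map_mx f d.
  by apply/rowP => i; rewrite !mxE /f RRe_real //; apply: (mxOverP Dreal).
have PV : invmx P *m P = 1%:M by rewrite mulVmx.
have DE : diag_mx D = map_mx f (diag_mx d) by rewrite map_diag_mx dE.
exists d; split.
- apply: (@map_poly_inj _ _ f); rewrite map_char_poly -/N NE char_poly_conj //.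
  by rewrite DE -map_char_poly char_poly_diag.
- apply: (@complexI R); transitivity (\tr N); first by rewrite trace_map_mx.
  rewrite NE.
  rewrite mxtrace_mulC mulmxA mulmxV // mul1mx mxtrace_diag.
  by rewrite [RHS]rmorph_sum; apply: eq_bigr => i _; rewrite dE mxE.
- rewrite (leq_trans (card_supp_le_rank_diag d)) //.
  rewrite -(mxrank_map f) -DE -(mxrank_map f M) -/N.
  have -> : diag_mx D = P *m N *m invmx P.
    by rewrite NE !mulmxA mulmxV // mul1mx -mulmxA mulmxV // mulmx1.
  exact: leq_trans (mxrankM_maxl _ _) (mxrankM_maxr _ _).
Qed.

(** * Singular values as a family indexed by the columns *)

Lemma perm_rootsR_prod (R : rcfType) (s : seq R) :
  perm_eq (rootsR (\prod_(x <- s) ('X - x%:P))) (undup s).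
Proof.
apply: uniq_perm; rewrite ?undup_uniq ?uniq_roots // => x.
have p0 : \prod_(x <- s) ('X - x%:P) != 0.
  exact: monic_neq0 (monic_prod_XsubC _ _ _).
by rewrite -roots_on_rootsR // root_prod_XsubC mem_undup.
Qed.

Lemma gram_quad_ge0 (R : realDomainType) m n (A : 'M[R]_(m, n)) (v : 'rV[R]_n) :
  0 <= (v *m (A^T *m A) *m v^T) 0 0.
Proof.
rewrite mulmxA -mulmxA -[A in _ *m (A *m _)]trmxK -trmx_mul mxE.
by apply: sumr_ge0 => i _; rewrite [X in _ * X]mxE -expr2 sqr_ge0.
Qed.

(** For an eigenvector [v], the quadratic form at [v] is both a square norm and [a] times the
    positive square norm of [v]. *)
Lemma eigenvalue_gram_ge0 (R : realFieldType) m n (A : 'M[R]_(m, n)) a :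
  eigenvalue (A^T *m A) a -> 0 <= a.
Proof.
case/eigenvalueP => v vE vn0; have := gram_quad_ge0 A v.
rewrite vE -scalemxAl mxE pmulr_lge0 // mxE.
under eq_bigr => i do rewrite [v^T _ _]mxE -expr2.
have [i vi0] : exists i, v 0 i != 0.
  by apply/existsP; apply: contraNT vn0 => /existsPn v0; apply/eqP/rowP => i;
     rewrite mxE; apply/eqP; rewrite -[_ == _]negbK v0.
rewrite (bigD1 i) //= ltr_pwDl ?exprn_even_gt0 //.
by apply: sumr_ge0 => j _; rewrite sqr_ge0.
Qed.

Lemma tr_gram (R : comNzRingType) m n (A : 'M[R]_(m, n)) :
  \tr (A^T *m A) = \sum_i \sum_j A i j ^+ 2.
Proof.
rewrite exchange_big; apply: eq_bigr => j _; rewrite mxE.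
by apply: eq_bigr => i _; rewrite mxE -expr2.
Qed.

(** Trades the sorted list for an unordered family on ['I_n], so that sums of singular values can be
    compared with the trace of the Gram matrix. *)
Lemma singular_valuesP (R : realType) m n (A : 'M[R]_(m, n)) :
  exists s : 'I_n -> R,
    [/\ perm_eq (singular_values A) (codom s),
        forall i, 0 <= s i,
        \sum_i s i ^+ 2 = \sum_i \sum_j A i j ^+ 2
      & (#|[set i | s i != 0%R]| <= \rank A)%N].
Proof.
have [|d [chE trE rkE]] := @symmetric_spectrum R n (A^T *m A).
  by rewrite trmx_mul trmxK.
have d0 i : 0 <= d 0 i.
  apply: (@eigenvalue_gram_ge0 _ _ _ A); rewrite eigenvalue_root_char chE.
  by rewrite /root horner_prod (bigD1 i) //= !hornerE subrr mul0r.
exists (fun i => Num.sqrt (d 0 i)); split.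
- rewrite /singular_values perm_sort.
  set D := [seq d 0 i | i : 'I_n].
  have -> : char_poly (A^T *m A) = \prod_(x <- D) ('X - x%:P).
    by rewrite chE big_image.
  rewrite (perm_trans (perm_flatten (perm_map _ (perm_rootsR_prod D)))) //.
  rewrite [codom _](_ : _ = map Num.sqrt D); last by rewrite -map_comp.
  (* [D] is rebuilt from its distinct elements, each repeated as often as it occurs; that count is
     its multiplicity as a root. *)
  rewrite -(permPr (perm_map _ (perm_count_undup D))) map_flatten -map_comp.
  under eq_map => x do rewrite mu_prod_XsubC.
  by under [X in perm_eq _ (_ X)]eq_map => x do rewrite /= map_nseq.
- by move=> i; rewrite sqrtr_ge0.
- rewrite -tr_gram trE; apply: eq_bigr => i _; exact: sqr_sqrtr.
- apply: leq_trans (mxrankM_maxr A^T A); apply: leq_trans rkE.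
  apply/subset_leq_card/subsetP => i; rewrite !inE; apply: contra_neq => ->.
  exact: sqrtr0.
Qed.

Lemma sigma1P (R : realType) m n (A : 'M[R]_(m, n)) : (0 < n)%N ->
  sigma1 A \in singular_values A /\
  {in singular_values A, forall x, x <= sigma1 A}.
Proof.
move=> n0; rewrite /sigma1.
have [s [sE _ _ _]] := singular_valuesP A.
have : size (singular_values A) = n by rewrite (perm_size sE) size_codom card_ord.
have : sorted (fun x y => y <= x) (singular_values A).
  by apply: sort_sorted => x y; exact: le_total.
(* The default value of [head] would matter only for an empty list, which [n0] excludes. *)
case: (singular_values A) => [_ n0'|x t /=]; first by rewrite -n0' in n0.
rewrite path_sortedE; last by move=> u v w uv vw; apply: le_trans vw uv.
move=> /andP[/allP xt _] _; split; first exact: mem_head.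
by move=> y; rewrite inE => /predU1P[->|/xt].
Qed.

(** * Frobenius norm against [sigma1] and the nuclear norm *)

Definition frob2 (R : realType) m n (A : 'M[R]_(m, n)) : R :=
  \sum_i \sum_j A i j ^+ 2.

Lemma frob2_ge0 (R : realType) m n (A : 'M[R]_(m, n)) : 0 <= frob2 A.
Proof. by do 2!apply: sumr_ge0 => ? _; rewrite sqr_ge0. Qed.

Lemma sigma1_ge0 (R : realType) m n (A : 'M[R]_(m, n)) : (0 < n)%N ->
  0 <= sigma1 A.
Proof.
move=> n0; have [s [sE s0 _ _]] := singular_valuesP A.
by have [] := sigma1P A n0; rewrite (perm_mem sE) => /codomP[i ->].
Qed.

Lemma sigma1_le_frob (R : realType) m n (A : 'M[R]_(m, n)) : (0 < n)%N ->
  sigma1 A ^+ 2 <= frob2 A.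
Proof.
move=> n0; have [s [sE _ sumE _]] := singular_valuesP A.
have [] := sigma1P A n0; rewrite (perm_mem sE) => /codomP[i ->] _.
rewrite /frob2 -sumE (bigD1 i) //= lerDl.
by apply: sumr_ge0 => j _; rewrite sqr_ge0.
Qed.

(** At most [\rank A] singular values are nonzero, and none exceeds [sigma1 A]. In rank 1 this
    bounds [sigma1] from below by the Frobenius norm. *)
Lemma frob_le_sigma1 (R : realType) m n (A : 'M[R]_(m, n)) : (0 < n)%N ->
  frob2 A <= (\rank A)%:R * sigma1 A ^+ 2.
Proof.
move=> n0; have [s [sE s0 sumE rkE]] := singular_valuesP A.
have [_ sge] := sigma1P A n0.
rewrite /frob2 -sumE (bigID (fun i => s i != 0)) /=.
rewrite [X in _ + X]big1 ?addr0; last first.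
  by move=> i /negPn/eqP->; rewrite expr0n.
apply: (@le_trans _ _ (\sum_(i | s i != 0) sigma1 A ^+ 2)).
  apply: ler_sum => i _; have sle : s i <= sigma1 A.
    by apply: sge; rewrite (perm_mem sE) codom_f.
  by rewrite ler_pXn2r ?nnegrE // (le_trans (s0 i)).
rewrite sumr_const -[leLHS]mulr_natl ler_wpM2r ?sqr_ge0 // ler_nat.
by apply: leq_trans rkE; rewrite cardsE.
Qed.

(* Cauchy-Schwarz over the nonzero singular values: the double sum of
   [(s i - s j) ^+ 2] over the support is nonnegative. *)
Lemma nuclear_norm_le_frob (R : realType) m n (A : 'M[R]_(m, n)) :
  nuclear_norm A ^+ 2 <= (\rank A)%:R * frob2 A.
Proof.
have [s [sE s0 sumE rkE]] := singular_valuesP A.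
rewrite /nuclear_norm (perm_big _ sE) big_image /= /frob2 -sumE.
pose P i := s i != 0.
rewrite (bigID P) /= [X in _ + X]big1 ?addr0; last by move=> i /negPn/eqP.
rewrite [X in _ <= _ * X](bigID P) /= [X in _ * (_ + X)]big1 ?addr0; last first.
  by move=> i /negPn/eqP->; rewrite expr0n.
apply: (@le_trans _ _ (#|P|%:R * \sum_(i | P i) s i ^+ 2)); last first.
  rewrite ler_wpM2r //; first by apply: sumr_ge0 => i _; rewrite sqr_ge0.
  by rewrite ler_nat; apply: leq_trans rkE; rewrite cardsE.
set S := \sum_(i | P i) s i; set Q := \sum_(i | P i) s i ^+ 2.
have : 0 <= \sum_(i | P i) \sum_(j | P j) (s i - s j) ^+ 2.
  by do 2!apply: sumr_ge0 => ? _; rewrite sqr_ge0.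
have -> : \sum_(i | P i) \sum_(j | P j) (s i - s j) ^+ 2
          = 2 * (#|P|%:R * Q - S ^+ 2).
  transitivity (\sum_(i | P i) (#|P|%:R * s i ^+ 2 - 2 * S * s i + Q)).
    apply: eq_bigr => i _.
    under eq_bigr => j _ do rewrite sqrrB.
    rewrite big_split sumrB /= sumr_const -[_ *+ #|_|]mulr_natl.
    suff -> : \sum_(j | P j) s i * s j *+ 2 = 2 * S * s i by [].
    by rewrite mulrAC mulr_sumr; apply: eq_bigr => j _; rewrite mulr_natl mulrnAl.
  rewrite big_split sumrB /= sumr_const -!mulr_sumr -[_ *+ #|_|]mulr_natl -/Q -/S.
  by ring.
by rewrite pmulr_rge0 // subr_ge0.
Qed.

Lemma le_of_sqr_le (R : realDomainType) (x y : R) :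
  0 <= y -> x ^+ 2 <= y ^+ 2 -> x <= y.
Proof.
move=> y0 xy; apply: le_trans (ler_norm x) _.
by rewrite -(ler_pXn2r (_ : 0 < 2)%N) ?nnegrE // real_normK ?num_real.
Qed.

(** * Choosing rows with few queries *)

(** Starting from all indices, delete a heaviest one repeatedly: the average of [f] never rises.
    Averages are cross-multiplied to stay in [nat]. *)
Lemma light_subset (n : nat) (f : 'I_n -> nat) k : (k <= n)%N ->
  exists2 I : {set 'I_n}, #|I| = k &
    (n * \sum_(i in I) f i <= k * \sum_i f i)%N.
Proof.
(* The induction is on the number [l] of deleted indices. *)
move=> /subKn <-; elim: (n - k)%N (leq_subr k n) => [_|l IH ln].
  exists [set: 'I_n]; rewrite ?cardsT ?card_ord subn0 //.
  by rewrite (eq_bigl xpredT) // => i; rewrite inE.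
have [I cI sI] := IH (ltnW ln).
have [i0 i0I] : exists i, i \in I by apply/card_gt0P; rewrite cI subn_gt0.
have [m mI mmax] := @arg_maxnP _ i0 [in I] f i0I.
rewrite /= in mI.
have cS : (n - l = (n - l.+1).+1)%N by rewrite subnSK.
have cI' : #|I :\ m| = (n - l.+1)%N.
  by apply: succn_inj; rewrite -cS -cI (cardsD1 m I) mI.
exists (I :\ m); first exact: cI'.
set T := (\sum_i f i)%N in sI *; rewrite cS in sI; rewrite -cI' in sI *.
have -> : (\sum_(i in I :\ m) f i = \sum_(i in I | i != m) f i)%N.
  by apply: eq_bigl => i; rewrite !inE andbC.
rewrite (bigD1 m) //= in sI.
set r := (\sum_(i in I | i != m) f i)%N in sI *.
have rle : (r <= #|I :\ m| * f m)%N.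
  rewrite -sum_nat_const /r.
  rewrite [leqRHS](eq_bigl (fun i => (i \in I) && (i != m))); last first.
    by move=> i; rewrite !inE andbC.
  by apply: leq_sum => i /andP[iI _]; apply: mmax.
move: #|_| rle sI => q rle sI.
(* From [r <= q * f m] follows [q.+1 * r <= q * (f m + r)], so the goal is scaled by [q.+1] to meet
   the induction hypothesis. *)
rewrite -(leq_pmul2l (ltn0Sn q)).
have h1 : (n * r <= n * (q * f m))%N by rewrite leq_mul2l rle orbT.
have h2 : (q * (n * (f m + r)) <= q * (q.+1 * T))%N by rewrite leq_mul2l sI orbT.
lia.
Qed.

(** [M] factors through its rows in [I]: the 0-1 matrix [P] puts them back in place. *)
Lemma rank_le_row_support (F : fieldType) m n (M : 'M[F]_(m, n))
    (I : {set 'I_m}) :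
  (forall i j, i \notin I -> M i j = 0) -> (\rank M <= #|I|)%N.
Proof.
move=> M0; pose P := \matrix_(i < m, k < #|I|) ((i == enum_val k)%:R : F).
have -> : M = P *m rowsub enum_val M.
  apply/matrixP => i j; rewrite mxE.
  under eq_bigr => k _ do rewrite !mxE.
  have [iI|iI] := boolP (i \in I); last first.
    rewrite M0 // big1 // => k _; case: eqP => [ik|_]; last by rewrite mul0r.
    by rewrite ik enum_valP in iI.
  rewrite -(enum_rankK_in iI iI) (bigD1 (enum_rank_in iI i)) //= eqxx mul1r.
  rewrite big1 ?addr0 // => k ki.
  by rewrite (inj_eq enum_val_inj) eq_sym (negPf ki) mul0r.
exact: mulmx_max_rank.
Qed.

(** * The two inputs that the queries cannot separate *)

Definition indicator_mx (R : realType) n (S : {set 'I_n * 'I_n}) : 'M[R]_n :=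
  \matrix_(i, j) ((i, j) \in S)%:R.

Lemma indicator_mx_bounded (R : realType) n (S : {set 'I_n * 'I_n}) :
  bounded_entries (indicator_mx R S).
Proof. by move=> i j; rewrite mxE; case: (_ \in _); rewrite ?normr1 ?normr0. Qed.

Lemma frob2_indicator_mx (R : realType) n (S : {set 'I_n * 'I_n}) :
  frob2 (indicator_mx R S) = #|S|%:R.
Proof.
rewrite /frob2 pair_big /= -sum1_card natr_sum [RHS]big_mkcond /=.
apply: eq_bigr => -[i j] _; rewrite mxE /=.
by case: (_ \in _); rewrite ?expr1n ?expr0n.
Qed.

Lemma card_rows_setI n (I : {set 'I_n}) (S : {set 'I_n * 'I_n}) :
  #|setX I setT :&: S| = (\sum_(i in I) #|[set j | (i, j) \in S]|)%N.
Proof.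
under eq_bigr => i _ do rewrite -sum1_card.
rewrite pair_big_dep /= -sum1_card; apply: eq_bigl => -[i j].
by rewrite !inE andbT.
Qed.

Lemma eq_run (R : realType) n (alg : nonadaptive_algorithm R n)
    (A B : 'M[R]_n) :
  (forall i j, (i, j) \in queries alg -> A i j = B i j) -> run alg A = run alg B.
Proof.
move=> AB; rewrite /run; congr output; apply/ffunP => -[[i j] ij].
by rewrite !ffunE /= AB.
Qed.

Lemma indistinguishable_pair (R : realType) n (Q : {set 'I_n * 'I_n}) a :
  (a <= n)%N ->
  exists A B : 'M[R]_n,
    [/\ bounded_entries A, bounded_entries B
      & forall i j, (i, j) \in Q -> A i j = B i j] /\
    [/\ (\rank A <= 1)%N, frob2 A = a%:R * n%:R, (\rank B <= a)%N
      & n%:R * frob2 B <= a%:R * #|Q|%:R].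
Proof.
move=> an; pose f (i : 'I_n) := #|[set j | (i, j) \in Q]|.
have [I cI fI] := light_subset f an.
pose S : {set 'I_n * 'I_n} := setX I setT.
exists (indicator_mx R S), (indicator_mx R (S :&: Q)); split; split.
- exact: indicator_mx_bounded.
- exact: indicator_mx_bounded.
- by move=> i j ij; rewrite !mxE [in RHS]inE ij andbT.
- have -> : indicator_mx R S = (\col_i (i \in I)%:R) *m (const_mx 1 : 'rV_n).
    by apply/matrixP => i j; rewrite !mxE big_ord1 !mxE mulr1 !inE andbT.
  exact: mulmx_max_rank.
- by rewrite frob2_indicator_mx cardsX cI cardsT card_ord natrM.
- rewrite -cI; apply: rank_le_row_support => i j iI.
  by rewrite mxE !inE (negPf iI).
- rewrite frob2_indicator_mx -!natrM ler_nat card_rows_setI (leq_trans fI) //.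
  (* As a part of the full square, [Q] can be counted row by row too. *)
  have QE : Q = setX setT setT :&: Q by apply/setP => p; rewrite !inE.
  rewrite leq_mul2l [in X in (_ <= X)%N]QE card_rows_setI.
  rewrite [X in (_ <= X)%N](eq_bigl xpredT) ?leqnn ?orbT //.
  by move=> i; rewrite inE.
Qed.

(** * Final estimates *)

(** Here [x] and [y] are the two values of [sigma1] and [v] the common answer. As [y <= x / 9], the
    gap is at least [8 / 9 * x] and at most [2 * eps * n]; so [x ^+ 2] is at most
    [81 / 16 * (eps * n) ^+ 2], but it exceeds [8 * (eps * n) ^+ 2]. *)
Lemma estimates_too_far (R : realFieldType) (eps n a x y v : R) :
  0 < n -> 8 * eps ^+ 2 * n < a ->
  0 <= x -> a * n <= x ^+ 2 -> 0 <= y -> 81 * y ^+ 2 <= a * n ->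
  `|x - v| <= eps * n -> `|y - v| <= eps * n -> False.
Proof.
move=> n0 a_gt x0 xa y0 ya; rewrite !ler_norml => /andP[_ xv] /andP[yv _].
have yx : 9 * y <= x by apply: le_of_sqr_le => //; rewrite exprMn; lra.
have x_le : x <= 9 / 4 * (eps * n) by lra.
have x2_le : x * x <= 9 / 4 * (eps * n) * (9 / 4 * (eps * n)).
  by rewrite ler_pM.
have an : 8 * eps ^+ 2 * n * n < a * n by rewrite ltr_pM2r.
have : 0 <= (eps * n) ^+ 2 by exact: sqr_ge0.
lra.
Qed.

(** Here [t] is [frob2 B] and [q] the number of queries. Both bounds come from
    [81 * eps ^+ 4 * t <= a]: the first by [1 < eps ^+ 4 * n], the second by squaring the upper
    bound on [a]. *)
Lemma few_queries_bounds (R : realFieldType) (eps n a t q : R) :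
  0 < eps -> 1 < eps ^+ 4 * n -> 0 < n -> 0 <= t ->
  0 < a -> a <= 9 * eps ^+ 2 * n ->
  81 * eps ^+ 4 * q < n -> n * t <= a * q ->
  81 * t <= a * n /\ a * t <= n ^+ 2.
Proof.
move=> eps0 eps4n n0 t0 a0 a_le q_lt t_le.
have e4 : 0 < 81 * eps ^+ 4 by rewrite mulr_gt0 ?exprn_gt0.
have t_lt : 81 * eps ^+ 4 * t <= a.
  rewrite -(ler_pM2l n0).
  have := ler_wpM2l (ltW e4) t_le; have := ler_wpM2l (ltW a0) (ltW q_lt); lra.
split.
  have := ler_wpM2l t0 (ltW eps4n); have := ler_wpM2l (ltW n0) t_lt; lra.
rewrite -(ler_pM2l e4).
have h1 : a * (81 * eps ^+ 4 * t) <= a * a by rewrite ler_pM2l.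
have h2 : a * a <= (9 * eps ^+ 2 * n) * (9 * eps ^+ 2 * n).
  by rewrite ler_pM // ltW.
lra.
Qed.

Lemma nuclear_norm_le (R : realType) m n (A : 'M[R]_(m, n)) (r c : R) :
  0 <= c -> (\rank A)%:R <= r -> r * frob2 A <= c ^+ 2 -> nuclear_norm A <= c.
Proof.
move=> c0 rkA rA; apply: le_of_sqr_le => //.
apply: le_trans (nuclear_norm_le_frob A) (le_trans _ rA).
by rewrite ler_wpM2r ?frob2_ge0.
Qed.

Theorem theorem6 (R : realType) :
  exists2 c : R, 0 < c &
    forall (n : nat) (eps : R),
      (0 < n)%N ->
      1 / n%:R `^ (1 / 4) < eps -> eps < 1 / 4 ->
      forall alg : nonadaptive_algorithm R n,
        (forall A : 'M[R]_n, bounded_entries A ->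
           `|sigma1 A - run alg A| <= eps * Num.max n%:R (nuclear_norm A)) ->
        c * (n%:R / eps ^+ 4) <= #|queries alg|%:R.
Proof.
(* 81 is the square of 9 in two roles: in [a <= 9 * eps ^+ 2 * n], and as the ratio of the two
   values of [sigma1]. *)
exists (1 / 81); first by lra.
move=> n eps n0 eps_gt eps_lt alg algP.
have n0R : 0 < n%:R :> R by rewrite ltr0n.
have eps0 : 0 < eps.
  by apply: le_lt_trans eps_gt; rewrite divr_ge0 ?powR_ge0.
have eps4n : 1 < eps ^+ 4 * n%:R.
  have w0 : 0 < n%:R `^ (1 / 4) :> R by apply: powR_gt0.
  have w4 : (n%:R `^ (1 / 4)) ^+ 4 = n%:R :> R.
    rewrite -powR_mulrn ?powR_ge0 // -powRrM mul1r.
    by rewrite mulVf ?pnatr_eq0 // powRr1.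
  by rewrite -[X in _ * X]w4 -exprMn exprn_egt1 // -ltr_pdivrMr.
(* This pays for rounding [8 * eps ^+ 2 * n] up to an integer below [9 * eps ^+ 2 * n]. *)
have eps2n : 1 <= eps ^+ 2 * n%:R.
  apply: (le_trans (ltW eps4n)); rewrite ler_pM2r //.
  have eps1 : eps <= 1 by lra.
  by rewrite ler_wiXn2l // ltW.
rewrite leNgt; apply/negP => q_lt.
have {}q_lt : 81 * eps ^+ 4 * #|queries alg|%:R < n%:R.
  have e4 : 0 < eps ^+ 4 by rewrite exprn_gt0.
  by move: q_lt; rewrite mulrA ltr_pdivlMr //; lra.
pose a := (Num.truncn (8 * eps ^+ 2 * n%:R)).+1.
have a_gt : 8 * eps ^+ 2 * n%:R < a%:R :> R by exact: truncnS_gt.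
have a_le : a%:R <= 9 * eps ^+ 2 * n%:R :> R.
  have : (Num.truncn (8 * eps ^+ 2 * n%:R))%:R <= 8 * eps ^+ 2 * n%:R.
    by rewrite truncn_le !mulr_ge0 ?exprn_ge0 // ltW.
  by rewrite /a -natr1; lra.
have a0 : 0 < a%:R :> R by rewrite ltr0n.
(* Since [eps < 1 / 4], the factor [9 * eps ^+ 2] is at most [9 / 16]. *)
have a_le_n : a%:R <= n%:R :> R.
  apply: le_trans a_le _; rewrite ger_pMl //.
  have : eps * eps <= 1 / 4 * (1 / 4) by rewrite ler_pM // ltW.
  by rewrite expr2; lra.
clearbody a.
have an : (a <= n)%N by rewrite -(ler_nat R).
have [A [B [[bA bB AB] [rkA frA rkB frB]]]] :=
  indistinguishable_pair R (queries alg) an.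
have [tn at_le] :=
  few_queries_bounds eps0 eps4n n0R (frob2_ge0 B) a0 a_le q_lt frB.
have nucA : nuclear_norm A <= n%:R.
  apply: (@nuclear_norm_le _ _ _ A 1) => //; first by rewrite lern1.
  by rewrite mul1r frA expr2 ler_pM2r.
have nucB : nuclear_norm B <= n%:R.
  by apply: (@nuclear_norm_le _ _ _ B a%:R) => //; rewrite ler_nat.
(* Both nuclear norms are at most [n], so the allowed error is [eps * n] on either input. *)
have := algP A bA; rewrite (max_idPl nucA) => errA.
have := algP B bB; rewrite (max_idPl nucB) -(eq_run AB) => errB.
apply: estimates_too_far a_gt _ _ _ _ errA errB => //; try exact: sigma1_ge0.
  rewrite -frA; apply: le_trans (frob_le_sigma1 A n0) _.
  by rewrite ler_piMl ?sqr_ge0 // lern1.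
apply: le_trans tn; rewrite ler_pM2l //; exact: sigma1_le_frob.
Qed.
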